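(* Let $\lambda=0$. Suppose that $n$ and $m$ are integers with $1\le n\le q$ and $0\le m<n$ such that $F_i(x,y)\equiv0$ and $G_i(x,y)\equiv 0$ for all $i<n$, and such that $G_{n+m}(0,0)\ne0$ and $G_{n+l}(0,0)=0$ for all $0\le l<m$. Suppose $G_{n+m}(0,0)>0$ and put $\mu=\sqrt{G_{n+m}(0,0)/w(0)}$. Let $x_\ast(t),y_\ast(t)$ be the solution of the perturbed system $$\frac{dx}{dt}=\partial_y H(x,y;\lambda)+F(x,y,t),\qquad \frac{dy}{dt}=-\partial_x H(x,y;\lambda)+G(x,y,t)$$ with asymptotics $$x_\ast(t)=\sum_{k=n+m}^{\infty}t^{-\frac{k}{2q}}x_k,\qquad y_\ast(t)=\sum_{k=2n}^{\infty}t^{-\frac{k}{2q}}y_k,\qquad t\to\infty,$$ where $x_k,y_k$ are real constants and $x_{n+m}=-\mu$. Then the solution $x_\ast(t),y_\ast(t)$ is unstable.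
   Context: Standing setting. The functions $H(x,y;\lambda)$, $F(x,y,t)$, $G(x,y,t)$ are smooth for all $(x,y)\in\mathbb R^2$, $t>0$, $\lambda\in\mathbb R$. The Hamiltonian of the limiting system is $H(x,y;\lambda)=\frac{y^2}{2}+V(x;\lambda)$ with $\partial_xV(x;\lambda)=(x^2-\lambda)w(x)$, where, for some $d_0>0$, $w(x)>0$ for all $(x,\lambda)\in\{|x|<\sqrt\lambda+d_0,\ \lambda\ge 0\}\cup\{|x|<d_0,\ \lambda<0\}$. The perturbations satisfy $F(x,y,t)\to0$ and $G(x,y,t)\to0$ as $t\to\infty$ for $(x,y)$ in any compact subset of $\mathbb R^2$, and have power-law asymptotics $$F(x,y,t)=\sum_{k=1}^\infty t^{-\frac kq}F_k(x,y),\qquad G(x,y,t)=\sum_{k=1}^\infty t^{-\frac kq}G_k(x,y),\qquad t\to\infty,$$ where $q$ is a positive integer and $F_k,G_k$ are smooth functions on $\mathbb R^2$. Infinite series followed by ''$t\to\infty$'' are understood as asymptotic expansions. The coefficients $x_k,y_k$ of the solution's expansion are those obtained by substituting the series into the system and equating the coefficients of equal powers of $t$. Stability and instability of a solution are understood in the sense of Lyapunov, as $t\to\infty$.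
   Formalization: The asymptotic expansions of F and G are taken uniformly on compact sets and assumed differentiable term by term once in x and in y; with expansions of the values alone, an exponentially small term near the solution can make it stable. *)

(* Defs.v *)
From Stdlib Require Export Reals.
From Coquelicot Require Export Coquelicot.
Local Open Scope R_scope.

(* Three-variable analogue of Coquelicot's [ex_diff_n]: [f] and all its iterated
   partial derivatives of order at most [p] exist and are jointly continuous at
   (x, y, z).  Only the germ of [f] at (x, y, z) matters. *)
Fixpoint ex_diff3_n (f : R -> R -> R -> R) (p : nat) (x y z : R) : Prop :=
  continuous (fun v : R * R * R => f (fst (fst v)) (snd (fst v)) (snd v))
             (x, y, z) /\
  match p with
  | O => True
  | S p' =>
      ex_derive (fun u => f u y z) x /\
      ex_derive (fun u => f x u z) y /\
      ex_derive (fun u => f x y u) z /\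
      ex_diff3_n (fun a b c => Derive (fun u => f u b c) a) p' x y z /\
      ex_diff3_n (fun a b c => Derive (fun u => f a u c) b) p' x y z /\
      ex_diff3_n (fun a b c => Derive (fun u => f a b u) c) p' x y z
  end.

Definition smooth2 (f : R -> R -> R) : Prop :=
  forall (p : nat) (x y : R), ex_diff_n f p x y.

Definition smooth3_on (D : R -> R -> R -> Prop) (f : R -> R -> R -> R) : Prop :=
  forall (p : nat) (x y z : R), D x y z -> ex_diff3_n f p x y z.

Definition d_x (f : R -> R -> R -> R) (x y t : R) : R :=
  Derive (fun u => f u y t) x.

Definition d_y (f : R -> R -> R -> R) (x y t : R) : R :=
  Derive (fun u => f x u t) y.

(* sum_{k = s}^{N} t^{-k/r} c_k, which is 0 when N < s *)
Definition power_sum (r s N : nat) (c : nat -> R) (t : R) : R :=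
  sum_n_m (fun k => Rpower t (- (INR k / INR r)) * c k) s N.

(* Every compact subset of R^2 lies in a square |x| <= M, |y| <= M, so uniformity
   on all such squares is uniformity on compact sets. *)
Definition vanishes_locally_uniformly (P : R -> R -> R -> R) : Prop :=
  forall M eps : R, 0 < eps ->
    Rbar_locally p_infty (fun t =>
      forall x y : R, Rabs x <= M -> Rabs y <= M -> Rabs (P x y t) <= eps).

(* P(x,y,t) ~ sum_{k >= 1} t^{-k/q} P_k(x,y) as t -> oo, in the sense of Poincare:
   each remainder is o(t^{-N/q}), uniformly on compact sets of (x,y). *)
Definition asymp_series (q : nat) (P : R -> R -> R -> R)
    (Pk : nat -> R -> R -> R) : Prop :=
  forall (N : nat) (M eps : R), 0 < eps ->
    Rbar_locally p_infty (fun t =>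
      forall x y : R, Rabs x <= M -> Rabs y <= M ->
        Rabs (P x y t - power_sum q 1 N (fun k => Pk k x y) t)
          <= eps * Rpower t (- (INR N / INR q))).

(* An asymptotic series in t for a function smooth in (x,y) is meant to be
   differentiable term by term in (x,y); only first derivatives are required.
   An expansion of the values alone would leave the linearization of the system
   about a given solution uncontrolled, since a remainder of size exp(- sqrt t)
   supported within distance exp(- sqrt t) of the solution can have derivatives of
   order one there. *)
Definition asymp_expansion (q : nat) (P : R -> R -> R -> R)
    (Pk : nat -> R -> R -> R) : Prop :=
  asymp_series q P Pk /\
  asymp_series q (d_x P) (fun k x y => Derive (fun u => Pk k u y) x) /\
  asymp_series q (d_y P) (fun k x y => Derive (fun u => Pk k x u) y).

(* z(t) ~ sum_{k >= s} t^{-k/r} c_k as t -> oo *)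
Definition asymp_series_from (r s : nat) (z : R -> R) (c : nat -> R) : Prop :=
  forall N : nat,
    is_lim (fun t => (z t - power_sum r s N c t) / Rpower t (- (INR N / INR r)))
           p_infty 0.

(* (x, y) solves x' = f(x,y,t), y' = g(x,y,t) on the open interval (a, b),
   contained in the half-line t > 0 where the right-hand sides are defined. *)
Definition is_solution (f g : R -> R -> R -> R) (a : R) (b : Rbar)
    (x y : R -> R) : Prop :=
  0 <= a /\
  forall t : R, a < t -> Rbar_lt t b ->
    is_derive x t (f (x t) (y t) t) /\ is_derive y t (g (x t) (y t) t).

(* Lyapunov stability of a solution (xs, ys) on (a, oo): solutions starting
   close enough to it at time t0 are defined for all t >= t0 and stay close to
   it.  The second clause ranges over local solutions, which may have finite
   lifetime b. *)
Definition lyapunov_stable (f g : R -> R -> R -> R) (a : R)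
    (xs ys : R -> R) : Prop :=
  forall t0 : R, a < t0 ->
  forall eps : R, 0 < eps ->
  exists delta : R, 0 < delta /\
  forall x0 y0 : R, dist_euc x0 y0 (xs t0) (ys t0) < delta ->
    (exists (c : R) (x y : R -> R),
        c < t0 /\ is_solution f g c p_infty x y /\ x t0 = x0 /\ y t0 = y0) /\
    (forall (c : R) (b : Rbar) (x y : R -> R),
        c < t0 -> Rbar_lt t0 b -> is_solution f g c b x y ->
        x t0 = x0 -> y t0 = y0 ->
        forall t : R, t0 <= t -> Rbar_lt t b ->
          dist_euc (x t) (y t) (xs t) (ys t) < eps).

Definition lyapunov_unstable (f g : R -> R -> R -> R) (a : R)
    (xs ys : R -> R) : Prop :=
  ~ lyapunov_stable f g a xs ys.

Definition field_x (H F : R -> R -> R -> R) (lam x y t : R) : R :=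
  d_y H x y lam + F x y t.

Definition field_y (H G : R -> R -> R -> R) (lam x y t : R) : R :=
  - d_x H x y lam + G x y t.

(* Main.v *)
Require Import Defs.
From Stdlib Require Import Reals Lra Lia Psatz Classical.
From Coquelicot Require Import Coquelicot.
Local Open Scope R_scope.

(** Put [p = xs - x] and [r = ys - y] for a second solution [(x, y)].  The
    solution [(xs, ys)] lies on the branch [xs ~ - mu s], [s = t^(-(n+m)/(2q))],
    where the potential is concave: its slope [x^2 w(x)] decreases in [x] at a rate
    of at least [k s], and this remains so for all smaller [x] in a fixed
    neighbourhood of 0 ([potential_slope_decreasing]).  Hence

      p' = r + O(rho) (p + r),   r' >= k s p - O(rho) (p + r),   rho = t^(-n/q),

    as long as [p, r > 0] stay below a fixed size.  The perturbation contributes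
    only [O(rho)] because [F], [G] start at order [n] and so do their first
    derivatives ([perturbation_lipschitz]); and [rho = o(s)] because [m < n].

    These inequalities hold in a corner of fixed size, hence well beyond the range
    of the linearized system.  For large [t] the product [p r] satisfies there

      (p r)' >= r^2 + k s p^2 - O(rho) (p + r)^2 >= rho p r >= p r / t,

    the last step because [n <= q] ([repelling_inequality]).  Thus [p r / t] is
    nondecreasing while both factors are positive, which at the same time keeps
    them positive and makes [p r] unbounded ([quadrant_growth]).  Stability would
    provide global solutions that start with [p, r > 0] arbitrarily small and keep
    [p r] bounded, a contradiction ([unstable_of_repelling_quadrant]). *)

(** * The invariant quadrant *)

(** Connectedness of a half-line as an induction principle: the supremum of the
    points up to which [P] holds satisfies [P] by the closure hypothesis, and the
    openness hypothesis moves past it. *)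
Lemma real_induction (P : R -> Prop) (a : R) :
  P a ->
  (forall t, a <= t -> P t -> exists d, 0 < d /\ forall s, t <= s < t + d -> P s) ->
  (forall t, a < t -> (forall s, a <= s < t -> P s) -> P t) ->
  forall t, a <= t -> P t.
Proof.
intros Pa Hopen Hclosed b Hb.
set (E := fun t => a <= t <= b /\ forall s, a <= s <= t -> P s).
destruct (completeness E) as [m [Hub Hlub]].
- exists b; intros t [Ht _]; lra.
- exists a; split; [lra | intros s Hs; now replace s with a by lra].
- assert (Ham : a <= m).
  { apply Hub; split; [lra | intros s Hs; now replace s with a by lra]. }
  assert (Hmb : m <= b) by (apply Hlub; intros t [Ht _]; lra).
  assert (Hbelow : forall s, a <= s < m -> P s).
  { intros s Hs.
    apply NNPP; intro HnP.
    assert (m <= s); [apply Hlub; intros t [Ht HP] | lra].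
    destruct (Rle_lt_dec t s) as [|Hst]; [easy | destruct HnP; apply HP; lra]. }
  assert (Pm : P m).
  { destruct (Req_dec a m) as [<- | Hne]; [easy | apply Hclosed; [lra | easy]]. }
  destruct (Rle_lt_or_eq_dec m b Hmb) as [Hlt | <-]; [exfalso | easy].
  destruct (Hopen m Ham Pm) as [d [Hd HP]].
  set (t := Rmin b (m + d / 2)).
  assert (Ht : m < t <= b /\ t <= m + d / 2).
  { unfold t; repeat split; [apply Rmin_glb_lt; lra | apply Rmin_l | apply Rmin_r]. }
  assert (t <= m); [apply Hub | lra].
  split; [lra | intros s Hs].
  destruct (Rlt_le_dec s m); [apply Hbelow; lra | apply HP; lra].
Qed.

Lemma continuous_pos_nearby (f : R -> R) (t l : R) :
  is_derive f t l -> 0 < f t ->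
  exists d, 0 < d /\ forall s, Rabs (s - t) < d -> 0 < f s.
Proof.
intros Hf Hpos.
assert (Hc : continuous f t) by (apply (ex_derive_continuous (V := R_NormedModule)); now exists l).
destruct (Hc (fun z => 0 < z)) as [d Hd].
- exists (mkposreal _ Hpos); intros z Hz.
  unfold ball in Hz; simpl in Hz; unfold AbsRing_ball, abs, minus, plus, opp in Hz; simpl in Hz.
  apply Rabs_def2 in Hz; lra.
- exists d; split; [apply cond_pos | intros s Hs; apply Hd, Hs].
Qed.

(** The hypothesis says that [p r / t] is nondecreasing while [p] and [r] are
    positive.  The same monotonicity proves that they stay positive: at a first
    exit time the product [p r] would vanish, but it is bounded below there by a
    positive multiple of [t].  Linear growth is what the weak rate [1 / t] gives,
    and unboundedness is all that instability requires. *)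
Lemma quadrant_growth (p r dp dr : R -> R) (t0 : R) :
  0 < t0 ->
  (forall t, t0 <= t -> is_derive p t (dp t)) ->
  (forall t, t0 <= t -> is_derive r t (dr t)) ->
  (forall t, t0 <= t -> 0 < p t -> 0 < r t ->
     p t * r t <= t * (dp t * r t + p t * dr t)) ->
  0 < p t0 -> 0 < r t0 ->
  forall t, t0 <= t -> p t0 * r t0 / t0 * t <= p t * r t.
Proof.
intros Ht0 Dp Dr Hineq Hp0 Hr0.
assert (Dq : forall t, t0 <= t -> is_derive (fun s => p s * r s / s) t
   ((t * (dp t * r t + p t * dr t) - p t * r t) / t ^ 2)).
{ intros t Ht.
  assert (Ep := is_derive_unique _ _ _ (Dp t Ht)).
  assert (Er := is_derive_unique _ _ _ (Dr t Ht)).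
  auto_derive.
  - repeat split; [now exists (dp t); apply Dp | now exists (dr t); apply Dr | lra].
  - change (fun x => p x) with p; change (fun x => r x) with r.
    rewrite Ep, Er; field; lra. }
assert (Hmono : forall t, t0 <= t -> (forall s, t0 <= s < t -> 0 < p s /\ 0 < r s) ->
   p t0 * r t0 / t0 * t <= p t * r t).
{ intros t Ht Hpos.
  destruct (Rle_lt_or_eq_dec _ _ Ht) as [Hlt | <-]; [| right; field; lra].
  destruct (MVT_cor2 (fun s => p s * r s / s)
    (fun t => (t * (dp t * r t + p t * dr t) - p t * r t) / t ^ 2) t0 t Hlt) as [c [Ec Hc]].
  { intros c Hc; apply is_derive_Reals, Dq; lra. }
  destruct (Hpos c) as [Hpc Hrc]; [lra |].
  assert (Hd : 0 <= (c * (dp c * r c + p c * dr c) - p c * r c) / c ^ 2).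
  { apply Rmult_le_pos; [specialize (Hineq c ltac:(lra) Hpc Hrc); lra |].
    apply Rlt_le, Rinv_0_lt_compat, pow_lt; lra. }
  assert (H1 : p t0 * r t0 / t0 <= p t * r t / t).
  { assert (0 <= p t * r t / t - p t0 * r t0 / t0); [rewrite Ec; apply Rmult_le_pos |]; lra. }
  apply (Rmult_le_compat_r t) in H1; [| lra].
  replace (p t * r t / t * t) with (p t * r t) in H1 by (field; lra).
  exact H1. }
assert (Hq : forall t, t0 <= t -> 0 < p t /\ 0 < r t).
{ apply real_induction; [easy | |].
  - intros t Ht [Hp Hr].
    destruct (continuous_pos_nearby _ _ _ (Dp t Ht) Hp) as [d1 [Hd1 H1]].
    destruct (continuous_pos_nearby _ _ _ (Dr t Ht) Hr) as [d2 [Hd2 H2]].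
    exists (Rmin d1 d2); split; [now apply Rmin_glb_lt |].
    intros s Hs.
    assert (Hm1 := Rmin_l d1 d2); assert (Hm2 := Rmin_r d1 d2).
    split; [apply H1 | apply H2]; rewrite Rabs_pos_eq; lra.
  - intros t Ht Hpos.
    assert (HW := Hmono t (Rlt_le _ _ Ht) Hpos).
    assert (0 < p t0 * r t0 / t0 * t).
    { apply Rmult_lt_0_compat; [apply Rdiv_lt_0_compat; [now apply Rmult_lt_0_compat |] |]; lra. }
    (* The product is positive at t, so it is enough to exclude p t < 0. *)
    assert (Hp : 0 <= p t).
    { apply Rnot_lt_le; intro Hneg.
      destruct (continuous_pos_nearby (fun s => - p s) t (- dp t)) as [d [Hd Hn]].
      - apply (is_derive_opp (V := R_NormedModule)), Dp; lra.
      - lra.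
      - set (s := Rmax t0 (t - d / 2)).
        assert (Hs : t0 <= s < t /\ t - d / 2 <= s).
        { unfold s; repeat split; [apply Rmax_l | apply Rmax_lub_lt; lra | apply Rmax_r]. }
        specialize (Hn s ltac:(rewrite Rabs_left; lra)).
        destruct (Hpos s) as [Hps _]; lra. }
    assert (Hp' : 0 < p t) by (destruct Hp as [|E0]; [easy | rewrite <- E0 in HW; lra]).
    split; [easy | apply Rmult_lt_reg_l with (p t); lra]. }
intros t Ht; apply Hmono; [easy | intros s Hs; apply Hq; lra].
Qed.

Lemma Rabs_le_dist_euc (x0 y0 x1 y1 : R) :
  Rabs (x0 - x1) <= dist_euc x0 y0 x1 y1 /\ Rabs (y0 - y1) <= dist_euc x0 y0 x1 y1.
Proof.
unfold dist_euc; split; rewrite <- sqrt_Rsqr_abs; apply sqrt_le_1_alt;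
  assert (H1 := Rle_0_sqr (x0 - x1)); assert (H2 := Rle_0_sqr (y0 - y1)); lra.
Qed.

(** The inequality compares [(xs, ys)] with the points to its lower left, in a box
    of fixed size [d].  Stability is contradicted with [eps = d], so that the
    comparison solution never leaves the box. *)
Lemma unstable_of_repelling_quadrant (f g : R -> R -> R -> R) (T : R) (xs ys : R -> R) (d : R) :
  is_solution f g T p_infty xs ys ->
  0 < d ->
  Rbar_locally p_infty (fun t => forall p r, 0 < p < d -> 0 < r < d ->
    p * r <= t * ((f (xs t) (ys t) t - f (xs t - p) (ys t - r) t) * r +
                  p * (g (xs t) (ys t) t - g (xs t - p) (ys t - r) t))) ->
  lyapunov_unstable f g T xs ys.
Proof.
intros [HT Hsol] Hd [M HM] Hstable.
set (t0 := Rmax T M + 1).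
assert (Ht0 : T < t0 /\ M < t0).
{ assert (H1 := Rmax_l T M); assert (H2 := Rmax_r T M); unfold t0; lra. }
destruct (Hstable t0 (proj1 Ht0) d Hd) as [delta [Hdelta Hst]].
destruct (Hst (xs t0 - delta / 2) (ys t0 - delta / 2)) as [[c [x [y [Hc [Hxy [Ex Ey]]]]]] Hclose].
{ unfold dist_euc.
  rewrite <- (sqrt_Rsqr delta) at 3 by lra.
  apply sqrt_lt_1_alt; unfold Rsqr; nra. }
specialize (Hclose c p_infty x y Hc I Hxy Ex Ey).
destruct Hxy as [_ Hxy].
assert (Hnear : forall t, t0 <= t -> Rabs (xs t - x t) < d /\ Rabs (ys t - y t) < d).
{ intros t Ht.
  specialize (Hclose t Ht I).
  destruct (Rabs_le_dist_euc (x t) (y t) (xs t) (ys t)).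
  rewrite (Rabs_minus_sym (xs t)), (Rabs_minus_sym (ys t)); lra. }
set (K := (xs t0 - x t0) * (ys t0 - y t0) / t0).
assert (Hgrow : forall t, t0 <= t -> K * t <= (xs t - x t) * (ys t - y t)).
{ apply (quadrant_growth (fun t => xs t - x t) (fun t => ys t - y t)
    (fun t => f (xs t) (ys t) t - f (x t) (y t) t)
    (fun t => g (xs t) (ys t) t - g (x t) (y t) t)); [lra | | | | |].
  - intros t Ht; apply (is_derive_minus (V := R_NormedModule)); [apply Hsol | apply Hxy]; simpl; lra.
  - intros t Ht; apply (is_derive_minus (V := R_NormedModule)); [apply Hsol | apply Hxy]; simpl; lra.
  - intros t Ht Hp Hr.
    destruct (Hnear t Ht) as [H1 H2].
    rewrite Rabs_pos_eq in H1, H2 by lra.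
    specialize (HM t ltac:(lra) (xs t - x t) (ys t - y t) ltac:(lra) ltac:(lra)).
    replace (xs t - (xs t - x t)) with (x t) in HM by ring.
    replace (ys t - (ys t - y t)) with (y t) in HM by ring.
    exact HM.
  - lra.
  - lra. }
assert (HK : 0 < K).
{ unfold K; rewrite Ex, Ey; apply Rdiv_lt_0_compat; [nra | lra]. }
(* By this time the product, growing at least like K t, has reached d^2. *)
set (t := t0 + d * d / K).
assert (Hdd : 0 < d * d / K) by (apply Rdiv_lt_0_compat; [nra | lra]).
assert (Ht : t0 <= t) by (unfold t; lra).
specialize (Hgrow t Ht).
assert (HKt : d * d <= K * t).
{ unfold t; replace (K * (t0 + d * d / K)) with (K * t0 + d * d) by (field; lra); nra. }
destruct (Hnear t Ht) as [H1 H2].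
apply Rabs_def2 in H1; apply Rabs_def2 in H2.
nra.
Qed.

(** * Decay rates and asymptotic series *)

Lemma lipschitz_of_Derive_bound (f : R -> R) (d K : R) :
  (forall c, Rabs c <= d -> ex_derive f c /\ Rabs (Derive f c) <= K) ->
  forall a b, Rabs a <= d -> Rabs b <= d -> Rabs (f b - f a) <= K * Rabs (b - a).
Proof.
intros Hf a b Ha Hb.
assert (Hseg : forall c, Rmin a b <= c <= Rmax a b -> Rabs c <= d).
{ intros c Hc; apply Rabs_le_between; apply Rabs_le_between in Ha; apply Rabs_le_between in Hb.
  revert Hc; unfold Rmin, Rmax; destruct (Rle_dec a b); lra. }
destruct (MVT_gen f a b (Derive f)) as [c [Hc ->]].
- intros c Hc; apply Derive_correct, Hf, Hseg; lra.
- intros c Hc; apply derivable_continuous_pt, ex_derive_Reals_0, Hf, Hseg, Hc.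
- rewrite Rabs_mult; apply Rmult_le_compat_r; [apply Rabs_pos | apply Hf, Hseg, Hc].
Qed.

Lemma Rpower_neg_lim (a : R) : 0 < a -> is_lim (fun t => Rpower t (- a)) p_infty 0.
Proof.
intro Ha; unfold Rpower.
apply (is_lim_comp exp _ p_infty 0 m_infty is_lim_exp_m).
- replace m_infty with (Rbar_mult (- a) p_infty).
  + apply is_lim_scal_l, is_lim_ln_p.
  + simpl; destruct (Rle_dec 0 (- a)); [exfalso; lra | easy].
- now exists 0.
Qed.

Lemma Rpower_neg_dominated (a b c K : R) :
  a < b -> 0 < c ->
  Rbar_locally p_infty (fun t => K * Rpower t (- b) <= c * Rpower t (- a)).
Proof.
intros Hab Hc.
assert (HK : 0 < c / (Rabs K + 1)).
{ apply Rdiv_lt_0_compat; [easy | assert (H := Rabs_pos K); lra]. }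
assert (H := proj2 (is_lim_spec _ _ _) (Rpower_neg_lim (b - a) ltac:(lra)) (mkposreal _ HK)).
apply filter_imp with (2 := H); simpl; intros t Ht.
replace (- b) with (- (b - a) + - a) by ring; rewrite Rpower_plus, <- Rmult_assoc.
apply Rmult_le_compat_r; [apply Rlt_le, exp_pos |].
rewrite Rminus_0_r in Ht; apply Rlt_le in Ht.
assert (HA := Rabs_pos K).
apply Rle_trans with (1 := Rle_abs _); rewrite Rabs_mult.
apply Rle_trans with ((Rabs K + 1) * (c / (Rabs K + 1))); [| right; field; lra].
apply Rmult_le_compat; try apply Rabs_pos; lra.
Qed.

Lemma power_sum_below (r s N : nat) (c : nat -> R) (t : R) :
  (N < s)%nat -> power_sum r s N c t = 0.
Proof. intro H; apply (sum_n_m_zero (G := R_AbelianMonoid)), H. Qed.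

Lemma power_sum_single (r s N : nat) (c : nat -> R) (t : R) :
  (s <= N)%nat -> (forall k, (s <= k < N)%nat -> c k = 0) ->
  power_sum r s N c t = Rpower t (- (INR N / INR r)) * c N.
Proof.
intros HsN Hc; unfold power_sum.
destruct N as [|N].
- replace s with 0%nat by lia; apply (sum_n_n (G := R_AbelianMonoid)).
- rewrite sum_n_Sm by easy.
  rewrite sum_n_m_ext_loc with (b := fun _ => zero).
  + rewrite sum_n_m_const_zero; apply plus_zero_l.
  + intros k Hk; rewrite Hc by lia; apply Rmult_0_r.
Qed.

(** This is the defining limit for [N = 0]: the partial sum is empty there and the
    normalizing power is [1]. *)
Lemma asymp_series_from_lim (r s : nat) (z : R -> R) (c : nat -> R) :
  (0 < s)%nat -> asymp_series_from r s z c -> is_lim z p_infty 0.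
Proof.
intros Hs Hz.
apply is_lim_ext_loc with (2 := Hz 0%nat).
exists 0; intros t Ht.
rewrite power_sum_below by easy.
replace (- (INR 0 / INR r)) with 0 by (simpl; unfold Rdiv; ring).
rewrite Rpower_O by easy; field.
Qed.

Lemma asymp_series_from_lead (r s : nat) (z : R -> R) (c : nat -> R) (eps : R) :
  asymp_series_from r s z c -> 0 < eps ->
  Rbar_locally p_infty (fun t =>
    Rabs (z t - c s * Rpower t (- (INR s / INR r))) <= eps * Rpower t (- (INR s / INR r))).
Proof.
intros Hz Heps.
assert (H := proj2 (is_lim_spec _ _ _) (Hz s) (mkposreal _ Heps)).
apply filter_imp with (2 := H); simpl; intros t Ht.
rewrite power_sum_single in Ht; [| easy | intros; lia].
assert (Hpos : 0 < Rpower t (- (INR s / INR r))) by apply exp_pos.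
rewrite Rminus_0_r, Rabs_div, (Rabs_pos_eq (Rpower _ _)), (Rmult_comm (Rpower _ _)) in Ht by lra.
apply Rlt_le, Rle_div_l in Ht; easy.
Qed.

(** The estimate is restricted to a neighbourhood of the origin so that continuity
    of the leading coefficient at one point bounds it. *)
Lemma asymp_series_bound (q n : nat) (D : R -> R -> R -> R) (Dk : nat -> R -> R -> R) :
  (1 <= n)%nat ->
  asymp_series q D Dk ->
  (forall k, (1 <= k < n)%nat -> forall x y, Dk k x y = 0) ->
  continuity_2d_pt (Dk n) 0 0 ->
  exists C d, 0 < C /\ 0 < d /\
    Rbar_locally p_infty (fun t => forall x y, Rabs x <= d -> Rabs y <= d ->
      Rabs (D x y t) <= C * Rpower t (- (INR n / INR q))).
Proof.
intros Hn HD Hzero Hcont.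
destruct (Hcont (mkposreal 1 Rlt_0_1)) as [d Hd]; simpl in Hd.
assert (Hd0 := cond_pos d).
exists (Rabs (Dk n 0 0) + 2), (d / 2).
assert (HA := Rabs_pos (Dk n 0 0)).
repeat split; [lra | lra |].
apply filter_imp with (2 := HD n (d / 2) 1 Rlt_0_1); intros t Ht x y Hx Hy.
specialize (Ht x y Hx Hy).
rewrite power_sum_single in Ht by (easy || (intros k Hk; now apply Hzero)).
specialize (Hd x y); rewrite !Rminus_0_r in Hd.
specialize (Hd ltac:(lra) ltac:(lra)).
set (rho := Rpower t (- (INR n / INR q))) in *.
assert (Hrho : 0 < rho) by apply exp_pos.
assert (HDn : Rabs (Dk n x y) <= Rabs (Dk n 0 0) + 1).
{ replace (Dk n x y) with (Dk n 0 0 + (Dk n x y - Dk n 0 0)) by ring.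
  apply Rle_trans with (1 := Rabs_triang _ _); lra. }
replace (D x y t) with (rho * Dk n x y + (D x y t - rho * Dk n x y)) by ring.
apply Rle_trans with (1 := Rabs_triang _ _).
rewrite Rabs_mult, (Rabs_pos_eq rho) by lra.
nra.
Qed.

(** The expansions of the two first derivatives start at order [n], so the mean
    value theorem in each variable gives a Lipschitz constant [O(t^(-n/q))]. *)
Lemma perturbation_lipschitz (q n : nat) (P : R -> R -> R -> R) (Pk : nat -> R -> R -> R) :
  (1 <= n)%nat ->
  smooth3_on (fun _ _ t => 0 < t) P ->
  asymp_expansion q P Pk ->
  (forall k, (1 <= k < n)%nat -> forall x y, Pk k x y = 0) ->
  smooth2 (Pk n) ->
  exists C d, 0 < C /\ 0 < d /\
    Rbar_locally p_infty (fun t => forall x1 y1 x2 y2,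
      Rabs x1 <= d -> Rabs y1 <= d -> Rabs x2 <= d -> Rabs y2 <= d ->
      Rabs (P x2 y2 t - P x1 y1 t) <=
        C * Rpower t (- (INR n / INR q)) * (Rabs (x2 - x1) + Rabs (y2 - y1))).
Proof.
intros Hn Psmooth [_ [Px Py]] Hzero Pksmooth.
destruct (Pksmooth 1%nat 0 0) as [_ [_ [_ [[HDx _] [HDy _]]]]].
destruct (asymp_series_bound q n _ _ Hn Px) as [C1 [d1 [HC1 [Hd1 B1]]]].
{ intros k Hk x y; rewrite (Derive_ext _ (fun _ => 0)); [apply Derive_const | intro; now apply Hzero]. }
{ exact HDx. }
destruct (asymp_series_bound q n _ _ Hn Py) as [C2 [d2 [HC2 [Hd2 B2]]]].
{ intros k Hk x y; rewrite (Derive_ext _ (fun _ => 0)); [apply Derive_const | intro; now apply Hzero]. }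
{ exact HDy. }
exists (C1 + C2), (Rmin d1 d2).
repeat split; [lra | now apply Rmin_glb_lt |].
assert (Hpos : Rbar_locally p_infty (fun t => 0 < t)) by (now exists 0).
apply filter_imp with (2 := filter_and _ _ Hpos (filter_and _ _ B1 B2)).
intros t [Ht [H1 H2]] x1 y1 x2 y2 Hx1 Hy1 Hx2 Hy2.
set (rho := Rpower t (- (INR n / INR q))) in *.
assert (Hrho : 0 < rho) by apply exp_pos.
assert (Hm1 := Rmin_l d1 d2); assert (Hm2 := Rmin_r d1 d2).
assert (L1 : Rabs (P x2 y1 t - P x1 y1 t) <= C1 * rho * Rabs (x2 - x1)).
{ apply (lipschitz_of_Derive_bound (fun u => P u y1 t) (Rmin d1 d2)); try easy.
  intros c Hc; split; [| apply H1; lra].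
  now destruct (Psmooth 1%nat c y1 t Ht) as [_ [Hex _]]. }
assert (L2 : Rabs (P x2 y2 t - P x2 y1 t) <= C2 * rho * Rabs (y2 - y1)).
{ apply (lipschitz_of_Derive_bound (fun u => P x2 u t) (Rmin d1 d2)); try easy.
  intros c Hc; split; [| apply H2; lra].
  now destruct (Psmooth 1%nat x2 c t Ht) as [_ [_ [Hex _]]]. }
replace (P x2 y2 t - P x1 y1 t) with ((P x2 y2 t - P x2 y1 t) + (P x2 y1 t - P x1 y1 t)) by ring.
apply Rle_trans with (1 := Rabs_triang _ _).
assert (HX := Rabs_pos (x2 - x1)); assert (HY := Rabs_pos (y2 - y1)).
assert (0 <= C2 * rho * Rabs (x2 - x1)) by (apply Rmult_le_pos; [apply Rmult_le_pos |]; lra).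
assert (0 <= C1 * rho * Rabs (y2 - y1)) by (apply Rmult_le_pos; [apply Rmult_le_pos |]; lra).
lra.
Qed.

(** * The slope of the potential near its degenerate point *)

Lemma ex_diff3_n_Derive_x (f : R -> R -> R -> R) (x y z : R) :
  ex_diff3_n f 1 x y z ->
  ex_derive (fun u => f u y z) x /\ continuous (Derive (fun u => f u y z)) x.
Proof.
intros [_ [Hex [_ [_ [[Hc _] _]]]]].
split; [exact Hex |].
apply (continuous_comp (fun u : R => (u, y, z))
   (fun v : R * R * R => Derive (fun u => f u (snd (fst v)) (snd v)) (fst (fst v)))); [| exact Hc].
assert (Hpair : forall (U W : UniformSpace) (v : U * W), continuous (fun v => (fst v, snd v)) v).
{ intros U W v; apply continuous_ext with (fun v => v); [now intros [] | apply continuous_id]. }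
apply (continuous_comp_2 (fun u : R => (u, y)) (fun _ => z) (fun a b => (a, b)));
  [| apply continuous_const | apply Hpair].
apply (continuous_comp_2 (fun u : R => u) (fun _ => y) (fun a b => (a, b)));
  [apply continuous_id | apply continuous_const | apply Hpair].
Qed.

(** The slope [x^2 w(x)] vanishes to second order at 0, so its derivative there
    does not control the variation of [w]; that of [(x^2 + 1) w(x)] does, since
    [x^2 + 1] has no zero. *)
Lemma weight_lipschitz (w : R -> R) :
  (forall x, ex_derive (fun u => (u ^ 2 + 1) * w u) x /\
             continuous (Derive (fun u => (u ^ 2 + 1) * w u)) x) ->
  exists K d, 0 < K /\ 0 < d /\
    forall a b, Rabs a <= d -> Rabs b <= d -> Rabs (w b - w a) <= K * Rabs (b - a).
Proof.
set (g := fun u => (u ^ 2 + 1) * w u).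
intros Hg.
destruct (proj2 (Hg 0) (fun z => Rabs (z - Derive g 0) < 1)) as [d Hd].
{ now exists (mkposreal 1 Rlt_0_1). }
assert (Hd0 := cond_pos d).
set (L := Rabs (Derive g 0) + 1).
set (e := Rmin (d / 2) 1).
assert (He : 0 < e <= 1 /\ e <= d / 2).
{ unfold e; repeat split; [apply Rmin_glb_lt; lra | apply Rmin_r | apply Rmin_l]. }
assert (HA := Rabs_pos (Derive g 0)); assert (HB := Rabs_pos (g 0)).
assert (Hlip : forall a b, Rabs a <= e -> Rabs b <= e -> Rabs (g b - g a) <= L * Rabs (b - a)).
{ apply lipschitz_of_Derive_bound; intros c Hc; split; [apply Hg |].
  specialize (Hd c).
  assert (Hb : Rabs (Derive g c - Derive g 0) < 1).
  { apply Hd; change (Rabs (c - 0) < d); rewrite Rminus_0_r; lra. }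
  replace (Derive g c) with (Derive g 0 + (Derive g c - Derive g 0)) by ring.
  apply Rle_trans with (1 := Rabs_triang _ _); unfold L; lra. }
assert (HL : 1 <= L) by (unfold L; lra).
exists (3 * L + 2 * Rabs (g 0)), e.
repeat split; [lra | lra |].
assert (Hw : forall a, Rabs (w a) <= Rabs (g a)).
{ intro a; unfold g; rewrite Rabs_mult, (Rabs_pos_eq (a ^ 2 + 1)) by nra.
  assert (H := Rabs_pos (w a)); nra. }
intros a b Ha Hb.
assert (Hga : Rabs (g a) <= Rabs (g 0) + L).
{ replace (g a) with (g 0 + (g a - g 0)) by ring.
  apply Rle_trans with (1 := Rabs_triang _ _).
  specialize (Hlip 0 a ltac:(rewrite Rabs_R0; lra) Ha); rewrite Rminus_0_r in Hlip; nra. }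
apply Rle_trans with (Rabs ((b ^ 2 + 1) * (w b - w a))).
{ rewrite Rabs_mult, (Rabs_pos_eq (b ^ 2 + 1)) by nra.
  assert (H := Rabs_pos (w b - w a)); nra. }
replace ((b ^ 2 + 1) * (w b - w a)) with ((g b - g a) + - ((b - a) * ((b + a) * w a)))
  by (unfold g; ring).
apply Rle_trans with (1 := Rabs_triang _ _).
rewrite Rabs_Ropp, !Rabs_mult.
assert (Hab : Rabs (b + a) <= 2) by (apply Rle_trans with (1 := Rabs_triang _ _); lra).
assert (Hp : Rabs (b + a) * Rabs (w a) <= 2 * (Rabs (g 0) + L)).
{ apply Rmult_le_compat; try apply Rabs_pos; [easy |].
  apply Rle_trans with (1 := Hw a), Hga. }
assert (HD := Rabs_pos (b - a)).
apply (Rmult_le_compat_l (Rabs (b - a))) in Hp; [| easy].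
specialize (Hlip a b Ha Hb); lra.
Qed.

(** On the negative side of 0 the difference quotient of [x^2 w(x)] is at most a
    negative multiple of the distance of [x2] from the degenerate point 0: the factor [x1^2 - x2^2 = (x2 - x1)(- x1 - x2)] provides it, and the
    variation of [w] only enters through [x2^2 (x2 - x1)], which is of higher
    order. *)
Lemma potential_slope_decreasing (w : R -> R) (K d : R) :
  0 < K -> 0 < d -> 0 < w 0 ->
  (forall a b, Rabs a <= d -> Rabs b <= d -> Rabs (w b - w a) <= K * Rabs (b - a)) ->
  exists e, 0 < e /\
    forall x1 x2, - e <= x1 -> x1 <= x2 -> x2 <= 0 ->
      w 0 / 2 * (- x2) * (x2 - x1) <= x1 ^ 2 * w x1 - x2 ^ 2 * w x2.
Proof.
intros HK Hd Hw Hlip.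
exists (Rmin d (w 0 / (4 * K))).
assert (Hm1 := Rmin_l d (w 0 / (4 * K))); assert (Hm2 := Rmin_r d (w 0 / (4 * K))).
split; [apply Rmin_glb_lt; [easy | apply Rdiv_lt_0_compat; lra] |].
intros x1 x2 H1 H12 H2.
assert (Hsmall : K * (- x1) <= w 0 / 4).
{ replace (w 0 / 4) with (K * (w 0 / (4 * K))) by (field; lra).
  apply Rmult_le_compat_l; lra. }
assert (B1 : w 0 / 2 <= w x1).
{ specialize (Hlip 0 x1 ltac:(rewrite Rabs_R0; lra) ltac:(rewrite Rabs_left1; lra)).
  apply Rabs_le_between in Hlip; rewrite Rminus_0_r, (Rabs_left1 x1) in Hlip by lra; lra. }
assert (B2 : w x2 - w x1 <= K * (x2 - x1)).
{ specialize (Hlip x1 x2 ltac:(rewrite Rabs_left1; lra) ltac:(rewrite Rabs_left1; lra)).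
  apply Rabs_le_between in Hlip; rewrite Rabs_pos_eq in Hlip by lra; lra. }
replace (x1 ^ 2 * w x1 - x2 ^ 2 * w x2)
  with ((x2 - x1) * ((- x1 - x2) * w x1) - x2 ^ 2 * (w x2 - w x1)) by ring.
assert (x2 ^ 2 * (w x2 - w x1) <= (x2 - x1) * ((- x2) * (w 0 / 4))).
{ apply Rle_trans with (x2 ^ 2 * (K * (x2 - x1))).
  - apply Rmult_le_compat_l; [nra | easy].
  - replace (x2 ^ 2 * (K * (x2 - x1))) with ((x2 - x1) * ((- x2) * (K * (- x2)))) by ring.
    apply Rmult_le_compat_l; [lra |]; apply Rmult_le_compat_l; nra. }
assert ((x2 - x1) * ((-2 * x2) * (w 0 / 2)) <= (x2 - x1) * ((- x1 - x2) * w x1)).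
{ apply Rmult_le_compat_l; [lra |]; apply Rmult_le_compat; lra. }
assert (0 <= (x2 - x1) * ((- x2) * w 0)) by (apply Rmult_le_pos; [| apply Rmult_le_pos]; lra).
lra.
Qed.

(** * Instability of the solution *)

(** [DF], [DG] and [Df] stand for the increments of the two perturbations and of
    the slope of the potential.  With [C = CF + CG], the terms [r^2] and [k s p^2] of
    [(p r)' = (r + DF) r + p (Df + DG)] are at least [(2 C + 1) rho] times [r^2]
    and [p^2]: by [2 p r <= p^2 + r^2], the part [2 C rho] pays for the
    perturbation and the remaining [rho (p^2 + r^2)] dominates [rho p r]. *)
Lemma repelling_inequality (CF CG k rho s p r DF DG Df : R) :
  0 < CF -> 0 < CG -> 0 < rho -> 0 < p -> 0 < r ->
  (2 * (CF + CG) + 1) * rho <= 1 ->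
  (2 * (CF + CG) + 1) * rho <= k * s ->
  Rabs DF <= CF * rho * (p + r) ->
  Rabs DG <= CG * rho * (p + r) ->
  k * s * p <= Df ->
  rho * (p * r) <= (r + DF) * r + p * (Df + DG).
Proof.
intros HCF HCG Hrho Hp Hr Eone Edom BF BG HDf.
apply Rabs_le_between in BF; apply Rabs_le_between in BG.
assert (HF : - (CF * rho * (p + r)) * r <= DF * r) by (apply Rmult_le_compat_r; lra).
assert (HG : p * - (CG * rho * (p + r)) <= p * DG) by (apply Rmult_le_compat_l; lra).
assert (Hf : p * (k * s * p) <= p * Df) by (apply Rmult_le_compat_l; lra).
assert (H1 : (2 * (CF + CG) + 1) * rho * (r * r) <= 1 * (r * r))
  by (apply Rmult_le_compat_r; [apply Rle_0_sqr | lra]).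
assert (H2 : (2 * (CF + CG) + 1) * rho * (p * p) <= k * s * (p * p))
  by (apply Rmult_le_compat_r; [apply Rle_0_sqr | lra]).
assert (Hsq : 2 * (p * r) <= p * p + r * r)
  by (assert (Hn := Rle_0_sqr (p - r)); unfold Rsqr in Hn; lra).
assert (HFsq := Rmult_le_compat_l (CF * rho) _ _ ltac:(apply Rmult_le_pos; lra) Hsq).
assert (HGsq := Rmult_le_compat_l (CG * rho) _ _ ltac:(apply Rmult_le_pos; lra) Hsq).
assert (Hrsq := Rmult_le_compat_l rho _ _ (Rlt_le _ _ Hrho) Hsq).
assert (0 <= CF * rho * (p * p)) by (repeat apply Rmult_le_pos; lra).
assert (0 <= CF * rho * (r * r)) by (repeat apply Rmult_le_pos; lra).
assert (0 <= CG * rho * (p * p)) by (repeat apply Rmult_le_pos; lra).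
assert (0 <= CG * rho * (r * r)) by (repeat apply Rmult_le_pos; lra).
assert (0 <= rho * (p * p)) by (repeat apply Rmult_le_pos; lra).
assert (0 <= rho * (r * r)) by (repeat apply Rmult_le_pos; lra).
lra.
Qed.

Theorem theorem5
  (H : R -> R -> R -> R) (V : R -> R -> R) (w : R -> R) (d0 : R)
  (F G : R -> R -> R -> R) (Fk Gk : nat -> R -> R -> R) (q : nat)
  (H_smooth : smooth3_on (fun _ _ _ => True) H)
  (F_smooth : smooth3_on (fun _ _ t => 0 < t) F)
  (G_smooth : smooth3_on (fun _ _ t => 0 < t) G)
  (H_def : forall x y lam : R, H x y lam = y ^ 2 / 2 + V x lam)
  (V_der : forall x lam : R,
      is_derive (fun u => V u lam) x ((x ^ 2 - lam) * w x))
  (d0_pos : 0 < d0)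
  (w_pos : forall x lam : R,
      (0 <= lam /\ Rabs x < sqrt lam + d0) \/ (lam < 0 /\ Rabs x < d0) ->
      0 < w x)
  (F_vanish : vanishes_locally_uniformly F)
  (G_vanish : vanishes_locally_uniformly G)
  (q_pos : (0 < q)%nat)
  (Fk_smooth : forall k : nat, (1 <= k)%nat -> smooth2 (Fk k))
  (Gk_smooth : forall k : nat, (1 <= k)%nat -> smooth2 (Gk k))
  (F_asymp : asymp_expansion q F Fk)
  (G_asymp : asymp_expansion q G Gk)
  (n m : nat)
  (n_range : (1 <= n <= q)%nat)
  (m_range : (m < n)%nat)
  (Fk_zero : forall i : nat, (1 <= i < n)%nat -> forall x y : R, Fk i x y = 0)
  (Gk_zero : forall i : nat, (1 <= i < n)%nat -> forall x y : R, Gk i x y = 0)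
  (G_lead_ne0 : Gk (n + m)%nat 0 0 <> 0)
  (G_low_zero : forall l : nat, (l < m)%nat -> Gk (n + l)%nat 0 0 = 0)
  (G_lead_pos : 0 < Gk (n + m)%nat 0 0)
  (mu : R)
  (mu_def : mu = sqrt (Gk (n + m)%nat 0 0 / w 0))
  (T : R) (xs ys : R -> R) (xk yk : nat -> R)
  (sol : is_solution (field_x H F 0) (field_y H G 0) T p_infty xs ys)
  (xs_asymp : asymp_series_from (2 * q) (n + m) xs xk)
  (ys_asymp : asymp_series_from (2 * q) (2 * n) ys yk)
  (xk_lead : xk (n + m)%nat = - mu) :
  lyapunov_unstable (field_x H F 0) (field_y H G 0) T xs ys.
Proof.
assert (dxH : forall x y lam, d_x H x y lam = (x ^ 2 - lam) * w x).
{ intros x y lam; unfold d_x.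
  rewrite (Derive_ext _ (fun u => y ^ 2 / 2 + V u lam)) by (intro; apply H_def).
  apply is_derive_unique.
  rewrite <- (Rplus_0_l (_ * w x)).
  apply (is_derive_plus (V := R_NormedModule)); [apply (is_derive_const (V := R_NormedModule)) | apply V_der]. }
assert (dyH : forall x y lam, d_y H x y lam = y).
{ intros x y lam; unfold d_y.
  rewrite (Derive_ext _ (fun u => u ^ 2 / 2 + V x lam)) by (intro; apply H_def).
  apply is_derive_unique; auto_derive; [easy | field]. }
assert (Hw0 : 0 < w 0).
{ apply (w_pos 0 0); left; rewrite Rabs_R0; assert (Hs := sqrt_pos 0); lra. }
assert (Hmu : 0 < mu).
{ rewrite mu_def; apply sqrt_lt_R0, Rdiv_lt_0_compat; easy. }
(* The value -1 of the parameter gives a multiple of w by a factor without zeros. *)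
assert (Hg : forall x y, d_x H x y (-1) = (x ^ 2 + 1) * w x).
{ intros x y; rewrite dxH; ring. }
destruct (weight_lipschitz w) as [K [dw [HK [Hdw Hwlip]]]].
{ intro x.
  destruct (H_smooth 2%nat x 0 (-1) I) as [_ [_ [_ [_ [H1 _]]]]].
  apply (ex_diff3_n_Derive_x (d_x H)) in H1; destruct H1 as [Hex Hc].
  split; [apply ex_derive_ext with (2 := Hex) | apply continuous_ext with (2 := Hc)]; intro u;
    [| apply Derive_ext; intro v]; apply Hg. }
destruct (potential_slope_decreasing w K dw HK Hdw Hw0 Hwlip) as [e [He Hslope]].
destruct (perturbation_lipschitz q n F Fk ltac:(lia) F_smooth F_asymp Fk_zero
  (Fk_smooth n ltac:(lia))) as [CF [dF [HCF [HdF BF]]]].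
destruct (perturbation_lipschitz q n G Gk ltac:(lia) G_smooth G_asymp Gk_zero
  (Gk_smooth n ltac:(lia))) as [CG [dG [HCG [HdG BG]]]].
set (d := Rmin e (Rmin dF dG)).
assert (Hd : 0 < d <= e /\ d <= dF /\ d <= dG).
{ assert (H1 := Rmin_l e (Rmin dF dG)); assert (H2 := Rmin_r e (Rmin dF dG)).
  assert (H3 := Rmin_l dF dG); assert (H4 := Rmin_r dF dG).
  unfold d; repeat split; try lra; repeat apply Rmin_glb_lt; easy. }
set (beta := INR (n + m) / INR (2 * q)).
set (nu := INR n / INR q).
assert (Hq : 0 < INR q) by (apply lt_0_INR; lia).
assert (Hbeta : 0 < beta).
{ apply Rdiv_lt_0_compat; apply lt_0_INR; lia. }
(* The Lipschitz constant O(t^(-nu)) of the perturbation is negligible against the rate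
   at which the slope of the potential decreases at xs, which is of order t^(-beta). *)
assert (Hnu : beta < nu).
{ unfold beta, nu; rewrite mult_INR, plus_INR; simpl (INR 2).
  apply Rmult_lt_reg_r with (2 * INR q); [lra |].
  replace (_ / (2 * INR q) * (2 * INR q)) with (INR n + INR m) by (field; lra).
  replace (INR n / INR q * (2 * INR q)) with (2 * INR n) by (field; lra).
  assert (INR m < INR n) by (apply lt_INR; lia); lra. }
(* At the same time t^(-nu) is at least the growth rate 1 / t. *)
assert (Hnu1 : nu <= 1).
{ apply Rle_div_l; [easy | rewrite Rmult_1_l; apply le_INR; lia]. }
(* Half the size, to leave room for xs and ys themselves, which tend to 0. *)
apply unstable_of_repelling_quadrant with (d := d / 2); [easy | lra |].
(* k s bounds the rate of decrease of the slope from below, since - xs >= (mu / 2) s. *)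
set (k := w 0 / 2 * (mu / 2)).
assert (Hk : 0 < k) by (unfold k; apply Rmult_lt_0_compat; lra).
assert (Hd2 : 0 < d / 2) by lra.
assert (Elead := asymp_series_from_lead _ _ _ _ (mu / 2) xs_asymp ltac:(lra)).
assert (Exs := proj2 (is_lim_spec _ _ _) (asymp_series_from_lim _ (n + m) _ _ ltac:(lia) xs_asymp)
  (mkposreal (d / 2) Hd2)).
assert (Eys := proj2 (is_lim_spec _ _ _) (asymp_series_from_lim _ (2 * n) _ _ ltac:(lia) ys_asymp)
  (mkposreal (d / 2) Hd2)).
assert (Edom := Rpower_neg_dominated beta nu k (2 * (CF + CG) + 1) Hnu Hk).
assert (Eone := Rpower_neg_dominated 0 nu 1 (2 * (CF + CG) + 1) ltac:(lra) Rlt_0_1).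
assert (Et : Rbar_locally p_infty (fun t => 1 < t)) by (now exists 1).
apply filter_imp with (2 := filter_and _ _ Et (filter_and _ _ Elead (filter_and _ _ Exs
  (filter_and _ _ Eys (filter_and _ _ Edom (filter_and _ _ Eone (filter_and _ _ BF BG))))))).
clear Elead Exs Eys Edom Eone Et BF BG.
intros t [Ht [Elead [Exs [Eys [Edom [Eone [BF BG]]]]]]] p r Hp Hr.
rewrite xk_lead in Elead; fold beta in Elead; fold nu in BF, BG.
cbn [pos] in Exs, Eys; rewrite Rminus_0_r in Exs, Eys.
rewrite Ropp_0, Rpower_O, Rmult_1_r in Eone by lra.
set (rho := Rpower t (- nu)) in *.
set (s := Rpower t (- beta)) in *.
assert (Hrho : 0 < rho) by apply exp_pos.
assert (Hs : 0 < s) by apply exp_pos.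
assert (Hxs : mu / 2 * s <= - xs t) by (apply Rabs_le_between in Elead; lra).
assert (Htrho : 1 <= t * rho).
{ unfold rho; rewrite <- (Rpower_1 t) at 1 by lra; rewrite <- Rpower_plus.
  rewrite <- (Rpower_O t) at 1 by lra; apply Rle_Rpower; lra. }
unfold field_x, field_y; rewrite !dxH, !dyH.
assert (Habs : forall z u, Rabs z < d / 2 -> 0 < u < d / 2 -> Rabs (z - u) <= d).
{ intros z u Hz Hu; apply Rabs_def2 in Hz; apply Rabs_le_between; lra. }
assert (Hx' := Habs _ _ Exs Hp); assert (Hy' := Habs _ _ Eys Hr).
specialize (BF (xs t - p) (ys t - r) (xs t) (ys t) ltac:(lra) ltac:(lra) ltac:(lra) ltac:(lra)).
specialize (BG (xs t - p) (ys t - r) (xs t) (ys t) ltac:(lra) ltac:(lra) ltac:(lra) ltac:(lra)).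
replace (xs t - (xs t - p)) with p in BF, BG by ring.
replace (ys t - (ys t - r)) with r in BF, BG by ring.
rewrite (Rabs_pos_eq p), (Rabs_pos_eq r) in BF, BG by lra.
assert (Hxs0 : xs t < 0) by nra.
specialize (Hslope (xs t - p) (xs t) ltac:(apply Rabs_le_between in Hx'; lra) ltac:(lra) ltac:(lra)).
replace (xs t - (xs t - p)) with p in Hslope by ring.
set (DF := F (xs t) (ys t) t - F (xs t - p) (ys t - r) t) in *.
set (DG := G (xs t) (ys t) t - G (xs t - p) (ys t - r) t) in *.
set (Df := (xs t - p) ^ 2 * w (xs t - p) - xs t ^ 2 * w (xs t)) in *.
replace ((ys t + F (xs t) (ys t) t - (ys t - r + F (xs t - p) (ys t - r) t))) with (r + DF)
  by (unfold DF; ring).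
replace (- ((xs t ^ 2 - 0) * w (xs t)) + G (xs t) (ys t) t -
  (- (((xs t - p) ^ 2 - 0) * w (xs t - p)) + G (xs t - p) (ys t - r) t)) with (Df + DG)
  by (unfold Df, DG; ring).
assert (HDf : k * s * p <= Df).
{ apply Rle_trans with (2 := Hslope); apply Rmult_le_compat_r; [lra |].
  unfold k; rewrite Rmult_assoc; apply Rmult_le_compat_l; lra. }
apply Rle_trans with (t * (rho * (p * r))).
- assert (Hpr : 0 < p * r) by (apply Rmult_lt_0_compat; lra).
  rewrite <- Rmult_assoc, <- (Rmult_1_l (p * r)) at 1.
  apply Rmult_le_compat_r; lra.
- apply Rmult_le_compat_l; [lra |].
  apply repelling_inequality with CF CG k s; easy || lra.
Qed.
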